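(* There exists a randomized algorithm that, given a positive integer $k$, a value $\varepsilon\in(0,1)$, and value-oracle access to a non-negative submodular function $f\colon 2^{\mathcal{N}}\to\mathbb{R}$ (with $|\mathcal{N}|=n$), outputs a set $S\subseteq\mathcal{N}$ with $|S|\le k$ which, with probability at least $1-\varepsilon$, satisfies \[ f(S)\ \ge\ \frac{f(S\cap\mathrm{OPT})+f(S\cup\mathrm{OPT})}{2+\varepsilon}\qquad\text{and}\qquad f(S)\ \ge\ \frac{f(S\cap\mathrm{OPT})}{1+\varepsilon}, \] where $\mathrm{OPT}\in\arg\max\{f(T): T\subseteq\mathcal{N},\,|T|\le k\}$. The number of value-oracle queries made by the algorithm is $O_\varepsilon(n+k^2)$, i.e., at most $C_\varepsilon(n+k^2)$ for a constant $C_\varepsilon$ depending only on $\varepsilon$.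
   Context: A set function $f\colon 2^{\mathcal{N}}\to\mathbb{R}$ is submodular if $f(A\cup\{s\})-f(A)\ge f(B\cup\{s\})-f(B)$ for all $A\subseteq B\subseteq\mathcal{N}$ and $s\in\mathcal{N}\setminus B$; non-negative means $f\ge 0$. A value-oracle query returns $f(A)$ for a queried set $A$. *)

(* Defs.v *)
From HB Require Import structures.
From mathcomp Require Import all_boot all_order all_algebra.
From mathcomp Require Import reals.
Set Implicit Arguments. Unset Strict Implicit. Unset Printing Implicit Defensive.
Import Order.TTheory GRing.Theory Num.Theory.
Local Open Scope ring_scope.

Definition submodular (R : realType) (T : finType) (f : {set T} -> R) : Prop :=
  forall (A B : {set T}) (s : T), A \subset B -> s \notin B ->
    f (s |: B) - f B <= f (s |: A) - f A.

Definition nonneg (R : realType) (T : finType) (f : {set T} -> R) : Prop :=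
  forall A, 0 <= f A.

(* Randomized value-oracle algorithms, as (well-founded) interaction trees:
   - Ret S        : stop and output S;
   - Query A c    : ask the oracle for f(A), continue with c (f A);
   - Sample m c   : draw i uniformly at random from {0,...,m}, continue with c i. *)
Inductive oalg (R : Type) (T : finType) : Type :=
| Ret of {set T}
| Query of {set T} & (R -> oalg R T)
| Sample (m : nat) of ('I_m.+1 -> oalg R T).

Fixpoint prob (R : realType) (T : finType) (a : oalg R T) (f : {set T} -> R)
  (P : {set T} -> bool) : R :=
  match a with
  | Ret X => if P X then 1 else 0
  | Query A c => prob (c (f A)) f P
  | Sample m c => (\sum_(i < m.+1) prob (c i) f P) / m.+1%:R
  end.

Fixpoint nqueries (R : realType) (T : finType) (a : oalg R T) (f : {set T} -> R)
  : nat :=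
  match a with
  | Ret _ => 0%N
  | Query A c => (nqueries (c (f A)) f).+1
  | Sample m c => (\max_(i < m.+1) nqueries (c i) f)%N
  end.

Fixpoint surely (R : realType) (T : finType) (a : oalg R T) (f : {set T} -> R)
  (P : {set T} -> bool) : bool :=
  match a with
  | Ret X => P X
  | Query A c => surely (c (f A)) f P
  | Sample m c => [forall i, surely (c i) f P]
  end.

Definition is_opt (R : realType) (T : finType) (f : {set T} -> R) (k : nat)
  (O : {set T}) : Prop :=
  (#|O| <= k)%N /\ forall S : {set T}, (#|S| <= k)%N -> f S <= f O.

Definition good (R : realType) (T : finType) (f : {set T} -> R) (k : nat)
  (eps : R) (O : {set T}) (S : {set T}) : bool :=
  [&& (#|S| <= k)%N,
      (f (S :&: O) + f (S :|: O)) / (2 + eps) <= f S &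
      f (S :&: O) / (1 + eps) <= f S].

(* Main.v *)
Require Import Defs.
From HB Require Import structures.
From mathcomp Require Import all_boot all_order all_algebra.
From mathcomp Require Import reals ring lra zify.
Set Implicit Arguments. Unset Strict Implicit. Unset Printing Implicit Defensive.
Import Order.TTheory GRing.Theory Num.Theory.
Local Open Scope ring_scope.

(** Two disjoint sets [A], [B] are grown greedily in one pass over the ground
    set, an element being accepted when its larger marginal is at least a [1/k]
    fraction of the current value.  Acceptance doubles the value every [k] steps, so
    the last [k] elements of the better set give [S0] with
    [f O <= 16 f S0] for every [O] of size at most [k].

    From [S0], padded with [k] dummy elements to size exactly [k], run [L]
    proportional to [n + k] steps of the following local search: draw one uniformly random
    element [u] and swap it with the element [v] of least removal loss if
    [f(u|S) - f(v|S - v) > tau := eps f(S0) / (2k)].  A step costs O(1) queries,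
    plus [k] queries to recompute [v] if the swap is accepted; as every accepted
    swap gains more than [tau], there are at most O(k / eps) of them.

    If [G(S)], the sum over [u] of the positive parts of the excess of the swap gain
    over [tau], is at most [eps f(S0) / 2], then submodularity gives
    [f(S :|: X) + f(S :&: X) <= (2 + eps) f(S)] for every [X] of size at most [k]; the
    two required bounds are the cases [X = O] and [X = S :&: O].  The expected
    increase of [f] in a step is at least [G(S) / (n + k)] and the total increase
    is at most [16 f(S0)], so stopping at a uniformly random time below [L] leaves a
    large [G] with probability at most [eps]. *)

(** * Inequalities for submodular functions *)

Section Submodular.
Variables (R : realType) (T : finType) (f : {set T} -> R).
Hypothesis f_sub : submodular f.
Implicit Types A B D S X : {set T}.

Lemma submodular_setU A B D :
  A \subset B -> [disjoint D & B] -> f (D :|: B) - f B <= f (D :|: A) - f A.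
Proof.
move=> sAB; move: D; suff H (s : seq T) : uniq s ->
    {in s, forall x, x \notin B} ->
    f ([set:: s] :|: B) - f B <= f ([set:: s] :|: A) - f A.
  move=> D /pred0P dDB; have := H (enum D) (enum_uniq _).
  rewrite set_enum; apply=> x; rewrite mem_enum => xD.
  by have := dDB x; rewrite /= xD => /= ->.
elim: s => [|x s IH] /=; first by rewrite set_nil !set0U !subrr.
rewrite set_cons => /andP [xs us] sB.
have /= := IH us (fun y ys => sB y (mem_behead (s := x :: s) ys)).
rewrite -!setUA.
have := @f_sub ([set:: s] :|: A) ([set:: s] :|: B) x (setUS _ sAB).
by rewrite !inE (negbTE xs) (negbTE (sB x (mem_head _ _))) => /(_ isT); lra.
Qed.

Lemma submodular_lattice A B : f (A :|: B) + f (A :&: B) <= f A + f B.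
Proof.
have := @submodular_setU (A :&: B) B (A :\: B) (subsetIr _ _).
have -> : A :\: B :|: B = A :|: B.
  by apply/setP=> x; rewrite !inE; case: (x \in A); case: (x \in B).
rewrite [A :\: B :|: _]setUC setID.
suff -> : [disjoint A :\: B & B] by move=> /(_ isT); lra.
by apply/pred0P=> x; rewrite /= !inE; case: (x \in B); rewrite ?andbF.
Qed.

Lemma submodular_setU_sum S D :
  f (S :|: D) - f S <= \sum_(u in D) (f (u |: S) - f S).
Proof.
suff H (s : seq T) : uniq s ->
    f (S :|: [set:: s]) - f S <= \sum_(u <- s) (f (u |: S) - f S).
  have := H _ (enum_uniq D); rewrite set_enum => /le_trans; apply.
  by rewrite big_enum.
elim: s => [|x s IH] /=; first by rewrite set_nil setU0 big_nil subrr.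
move=> /andP[xs us]; rewrite big_cons set_cons; have := IH us.
case: (boolP (x \in S)) => xS.
  have -> : x |: S = S by apply/setUidPr; rewrite sub1set.
  have -> : S :|: (x |: [set:: s]) = S :|: [set:: s].
    by rewrite setUCA setUA; congr (_ :|: _); apply/setUidPr; rewrite sub1set.
  by lra.
have := @f_sub S (S :|: [set:: s]) x (subsetUl _ _).
rewrite !inE (negbTE xS) (negbTE xs) setUCA => /(_ isT); lra.
Qed.

(** Complementation turns removals into insertions; this is how the bound on marginal gains yields
    the one on removal losses in [submodular_setD_sum]. *)
Lemma submodularC : submodular (fun X => f (~: X)).
Proof.
move=> A B s sAB sB /=.
have E X : s \notin X -> ~: X = s |: ~: (s |: X).
  by move=> sX; apply/setP=> x; rewrite !inE; case: eqP => [->|].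
have sA : s \notin A by apply: contra sB; apply/subsetP.
rewrite (E _ sA) (E _ sB).
have := @f_sub (~: (s |: B)) (~: (s |: A)) s.
rewrite !inE eqxx setCS => /(_ (setUS _ sAB) isT); lra.
Qed.

End Submodular.

Lemma submodular_setD_sum (R : realType) (T : finType) (f : {set T} -> R)
    (S D : {set T}) : submodular f ->
  \sum_(v in D) (f S - f (S :\ v)) <= f S - f (S :\: D).
Proof.
move=> f_sub; have := submodular_setU_sum (submodularC f_sub) (~: S) D.
rewrite /= setCK setCU setCK -setDE.
have -> : \sum_(u in D) (f (~: (u |: ~: S)) - f S)
    = - \sum_(v in D) (f S - f (S :\ v)); last by lra.
rewrite -sumrN; apply: eq_bigr => v _; rewrite opprB.
by congr (f _ - _); rewrite setCU setCK setDE setIC.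
Qed.

(** * Oracle algorithms *)

Section Oracle.
Variables (R : realType) (T : finType).
Implicit Types (f : {set T} -> R) (a b : oalg R T) (P Q : {set T} -> bool).

(** For a fixed [f] all answers are determined, so a deterministic prefix of a program can be
    executed, at a cost of [q] queries, and replaced by what remains. *)
Definition reduces f (q : nat) a b :=
  [/\ forall P, prob a f P = prob b f P,
      forall P, surely a f P = surely b f P
    & nqueries a f = (q + nqueries b f)%N].

Lemma reduces_refl f a : reduces f 0 a a. Proof. by []. Qed.

Lemma reduces_trans f q r a b c :
  reduces f q a b -> reduces f r b c -> reduces f (q + r) a c.
Proof.
move=> [pab sab nab] [pbc sbc nbc]; split=> [P|P|].
- by rewrite pab.
- by rewrite sab.
- by rewrite nab nbc addnA.
Qed.

Lemma reduces_query f q A (c : R -> oalg R T) b :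
  reduces f q (c (f A)) b -> reduces f q.+1 (Query A c) b.
Proof. by case=> p s n; split=> //=; rewrite n. Qed.

Lemma sub_surely f a P Q :
  (forall X, P X -> Q X) -> surely a f P -> surely a f Q.
Proof.
move=> PQ; elim: a => [X|A c IH|m c IH] /=; [exact: PQ|exact: IH|].
by move=> /forallP cP; apply/forallP => i; apply: IH.
Qed.

Lemma surely_prob f a P : surely a f P -> prob a f P = 1.
Proof.
elim: a => [X|A c IH|m c IH] /=; [by move->|exact: IH|].
move=> /forallP cP; rewrite (eq_bigr (fun=> 1)); last by move=> i _; apply: IH.
by rewrite sumr_const card_ord divff // pnatr_eq0.
Qed.

(** Like every procedure below, it takes the rest of the program as a continuation, in place of a
    sequencing operation on trees. *)
Fixpoint ask_all (l : seq {set T}) (c : seq R -> oalg R T) : oalg R T :=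
  if l is A :: l' then Query A (fun y => ask_all l' (fun ys => c (y :: ys)))
  else c [::].

Lemma ask_all_reduces f l c : reduces f (size l) (ask_all l c) (c (map f l)).
Proof.
elim: l c => [|A l IH] c; first exact: reduces_refl.
by apply: reduces_query; apply: IH.
Qed.

End Oracle.

(** * A linear-time constant-factor approximation *)

Section Twin.
Variables (R : realType) (T : finType) (k : nat).
Hypothesis k_gt0 : (0 < k)%N.

(* [A] and [B] list the accepted elements newest first, so that [take k] returns the last [k] of them. *)
Fixpoint twin (l A B : seq T) (c : seq T -> seq T -> oalg R T) : oalg R T :=
  if l is e :: l' then
    Query [set:: A] (fun a => Query [set:: B] (fun b =>
    Query [set:: e :: A] (fun a' => Query [set:: e :: B] (fun b' =>
    if b' - b <= a' - a then
      if a <= k%:R * (a' - a) then twin l' (e :: A) B c else twin l' A B c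
    else
      if b <= k%:R * (b' - b) then twin l' A (e :: B) c else twin l' A B c))))
  else c A B.

Variable f : {set T} -> R.
Hypothesis f_sub : submodular f.
Hypothesis f_ge0 : nonneg f.
Implicit Types (l A B s : seq T) (O : {set T}).

Fixpoint growing s : bool :=
  if s is e :: s' then
    (f [set:: s'] <= k%:R * (f [set:: s] - f [set:: s'])) && growing s'
  else true.

(** Values never decrease along an accepted list, so each of the [i] newest steps gains at least [f
    [set:: drop i s] / k]. *)
Lemma growing_drop s i : growing s -> (i <= size s)%N ->
  (k + i)%:R * f [set:: drop i s] <= k%:R * f [set:: s].
Proof.
elim: s i => [|e s IH] [|i] //=; rewrite ?addn0 //.
move=> /andP[es gs]; rewrite ltnS => /(IH _ gs).
have kR : 0 < k%:R :> R by rewrite ltr0n.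
rewrite addnS mulrSr !natrD => H.
have : f [set:: drop i s] <= f [set:: s].
  rewrite -(ler_pM2l kR); apply: le_trans H.
  by rewrite mulrDl lerDl mulr_ge0.
lra.
Qed.

(** The elements before the last [k] hold at most half of the value, by [growing_drop] with [i = k];
    by subadditivity the last [k] hold the other half. *)
Lemma growing_take s : growing s -> f [set:: s] <= 2 * f [set:: take k s].
Proof.
move=> gs; case: (leqP (size s) k) => [sk|/ltnW sk].
  by rewrite take_oversize //; have := f_ge0 [set:: s]; lra.
have kR : 0 < k%:R :> R by rewrite ltr0n.
have := growing_drop gs sk; rewrite natrD -mulr2n -[_ *+ 2]mulr_natl mulrAC mulrC.
rewrite ler_pM2l // => H.
have := submodular_lattice f_sub [set:: take k s] [set:: drop k s].
have -> : [set:: take k s] :|: [set:: drop k s] = [set:: s].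
  by apply/setP=> x; rewrite !inE -mem_cat cat_take_drop.
have := f_ge0 ([set:: take k s] :&: [set:: drop k s]); lra.
Qed.

(* [l] is the part of the ground set still to be read; adding up the two marginals
   makes the accepted gains pay for the elements of [O] taken by the other set. *)
Definition twin_inv l A B : Prop :=
  [/\ growing A, growing B, [disjoint [set:: A] & [set:: B]],
      [disjoint [set:: A] & [set:: l]] /\ [disjoint [set:: B] & [set:: l]]
    & forall O,
      k%:R * (f ([set:: A] :|: O :\: [set:: l]) + f ([set:: B] :|: O :\: [set:: l])
        - 2 * (f [set:: A] + f [set:: B]))
      <= 2 * #|O :\: [set:: l]|%:R * (f [set:: A] + f [set:: B])].

Lemma twin_invC l A B : twin_inv l A B -> twin_inv l B A.
Proof.
case=> gA gB dAB [dA dB] H; split=> // [|O]; first by rewrite disjoint_sym.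
by have := H O; lra.
Qed.

Lemma disjoint_cons A e l : [disjoint [set:: A] & [set:: e :: l]] ->
  e \notin A /\ [disjoint [set:: A] & [set:: l]].
Proof.
rewrite set_cons disjoint_sym disjoints_subset subUset sub1set !inE => /andP[eA].
by rewrite -disjoints_subset disjoint_sym.
Qed.

Lemma setD_cons e l O : uniq (e :: l) ->
  O :\: [set:: l] = (if e \in O then e |: O :\: [set:: e :: l] else O :\: [set:: e :: l]).
Proof.
move=> /= /andP[el _]; rewrite set_cons; apply/setP=> x.
by case: ifP => eO; rewrite !inE; case: (eqVneq x e) => [->|_];
  rewrite ?(negbTE el) ?eO ?andbF.
Qed.

(** The left-hand side of the invariant does not increase: the gain over [A] is the larger one and,
    counted twice, pays for adding [e] to both unions. *)
Lemma twin_inv_add e l A B : uniq (e :: l) -> twin_inv (e :: l) A B ->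
  f [set:: e :: B] - f [set:: B] <= f [set:: e :: A] - f [set:: A] ->
  f [set:: A] <= k%:R * (f [set:: e :: A] - f [set:: A]) ->
  twin_inv l (e :: A) B.
Proof.
move=> uel [gA gB dAB [/disjoint_cons [eA dA] /disjoint_cons [eB dB]] H] leAB geA.
have [el _] := andP uel.
have kR : 0 < k%:R :> R by rewrite ltr0n.
have gainA : 0 <= f [set:: e :: A] - f [set:: A].
  by rewrite -(ler_pM2l kR) mulr0 (le_trans _ geA).
have disjU (X : {set T}) : e \notin X -> [disjoint [set:: A] & X] ->
    [disjoint [set:: e :: A] & X].
  move=> eX; rewrite set_cons !disjoints_subset subUset sub1set inE eX.
  by [].
split=> //=; first by rewrite geA.
- by apply: disjU; rewrite ?inE.
- by split=> //; apply: disjU; rewrite ?inE.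
move=> O; have := H O; rewrite (setD_cons _ uel).
set OP := O :\: [set:: e :: l] => HO.
have eOP : e \notin OP by rewrite !inE eqxx.
have := f_sub (subsetUl [set:: A] OP) (s := e).
rewrite in_setU (negbTE eOP) inE (negbTE eA) -!set_cons => /(_ isT) margA.
have := f_sub (subsetUl [set:: B] OP) (s := e).
rewrite in_setU (negbTE eOP) inE (negbTE eB) -!set_cons => /(_ isT) margB.
have -> : [set:: e :: A] :|: (if e \in O then e |: OP else OP)
    = e |: ([set:: A] :|: OP).
  rewrite set_cons -setUA; case: ifP => // _.
  by apply/setP=> x; rewrite ![x \in _ :|: _]inE; case: (x \in [set e]); rewrite ?orbT.
have : 0 <= #|OP|%:R * (f [set:: e :: A] - f [set:: A]) by rewrite mulr_ge0.
move: margA; rewrite -(ler_pM2l kR); case: ifP => _ margA.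
  rewrite cardsU1 eOP add1n mulrS [[set:: B] :|: _]setUCA.
  move: margB leAB; rewrite -(ler_pM2l kR) -(ler_pM2l kR (_ - _)) => margB leAB.
  have := f_ge0 [set:: e :: A]; have := f_ge0 [set:: B].
  lra.
have := f_ge0 [set:: A]; lra.
Qed.

(** Only [e \in O] matters: [k] times either marginal is then at most [f [set:: A]], and the larger
    cardinal on the right pays for both. *)
Lemma twin_inv_skip e l A B : uniq (e :: l) -> twin_inv (e :: l) A B ->
  f [set:: e :: B] - f [set:: B] <= f [set:: e :: A] - f [set:: A] ->
  k%:R * (f [set:: e :: A] - f [set:: A]) <= f [set:: A] ->
  twin_inv l A B.
Proof.
move=> uel [gA gB dAB [/disjoint_cons [eA dA] /disjoint_cons [eB dB]] H] leAB leA.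
have kR : 0 < k%:R :> R by rewrite ltr0n.
split=> // O; have := H O; rewrite (setD_cons _ uel); case: ifP => // _.
set OP := O :\: [set:: e :: l] => HO.
have eOP : e \notin OP by rewrite !inE eqxx.
have := f_sub (subsetUl [set:: A] OP) (s := e).
rewrite in_setU (negbTE eOP) inE (negbTE eA) -!set_cons -(ler_pM2l kR) => /(_ isT) margA.
have := f_sub (subsetUl [set:: B] OP) (s := e).
rewrite in_setU (negbTE eOP) inE (negbTE eB) -!set_cons -(ler_pM2l kR) => /(_ isT) margB.
move: leAB; rewrite -(ler_pM2l kR) => leAB.
rewrite cardsU1 eOP add1n mulrS ![_ :|: (e |: _)]setUCA.
have := f_ge0 [set:: B]; lra.
Qed.

Lemma twin_reduces l A B : uniq l -> twin_inv l A B ->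
  exists A' B', twin_inv [::] A' B' /\
    forall c, reduces f (4 * size l) (twin l A B c) (c A' B').
Proof.
elim: l A B => [|e l IH] A B ul inv.
  by exists A, B; split=> // c; apply: reduces_refl.
have ul' : uniq l by case/andP: ul.
suff [A1 [B1 [inv1 red1]]] : exists A1 B1, twin_inv l A1 B1 /\
    forall c, reduces f 4 (twin (e :: l) A B c) (twin l A1 B1 c).
  have [A' [B' [inv' red']]] := IH _ _ ul' inv1.
  exists A', B'; split=> // c; rewrite mulnS.
  exact: reduces_trans (red1 c) (red' c).
have [leAB|ltBA] :=
    lerP (f [set:: e :: B] - f [set:: B]) (f [set:: e :: A] - f [set:: A]).
- have [geA|ltA] := lerP (f [set:: A]) (k%:R * (f [set:: e :: A] - f [set:: A])).
  + exists (e :: A), B; split; first exact: twin_inv_add geA.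
    by move=> c; do 4!apply: reduces_query; rewrite leAB geA; apply: reduces_refl.
  + exists A, B; split; first exact: twin_inv_skip (ltW ltA).
    move=> c; do 4!apply: reduces_query; rewrite leAB (lt_geF ltA).
    exact: reduces_refl.
- have [geB|ltB] := lerP (f [set:: B]) (k%:R * (f [set:: e :: B] - f [set:: B])).
  + exists A, (e :: B); split.
      by apply/twin_invC/(twin_inv_add ul (twin_invC inv) (ltW ltBA)).
    move=> c; do 4!apply: reduces_query; rewrite (lt_geF ltBA) geB.
    exact: reduces_refl.
  + exists A, B; split.
      by apply/twin_invC/(twin_inv_skip ul (twin_invC inv) (ltW ltBA))/ltW.
    move=> c; do 4!apply: reduces_query; rewrite (lt_geF ltBA) (lt_geF ltB).
    exact: reduces_refl.
Qed.

Definition start (c : {set T} -> oalg R T) : oalg R T :=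
  twin (enum T) [::] [::] (fun A B =>
    Query [set:: take k A] (fun a => Query [set:: take k B] (fun b =>
      c (if b <= a then [set:: take k A] else [set:: take k B])))).

Lemma card_take s : (#|[set:: take k s]| <= k)%N.
Proof. by rewrite cardsE (leq_trans (card_size _)) // size_take_min geq_minl. Qed.

(** The constant is 4 * 2 * 2: the final invariant gives [f O <= 4 * (f A + f B)], as [O] is the
    intersection of its unions with the disjoint [A] and [B]; truncation costs a factor 2, and the
    better of two sets another. *)
Lemma start_reduces : exists S0 : {set T},
  [/\ (#|S0| <= k)%N, forall O, (#|O| <= k)%N -> f O <= 16 * f S0
    & forall c, reduces f (4 * #|T| + 2) (start c) (c S0)].
Proof.
have inv0 : twin_inv (enum T) [::] [::].
  split=> //; rewrite ?set_nil ?disjoints_subset ?sub0set //.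
  move=> O; have -> : O :\: [set:: enum T] = set0.
    by apply/setP=> x; rewrite !inE mem_enum.
  rewrite !setU0 cards0.
  have : 0 <= k%:R * f set0 by rewrite mulr_ge0.
  lra.
have [A [B [[gA gB dAB _ H] red]]] := twin_reduces (enum_uniq T) inv0.
exists (if f [set:: take k B] <= f [set:: take k A]
  then [set:: take k A] else [set:: take k B]); split.
- by case: ifP => _; apply: card_take.
- move=> O Ok; have := H O; rewrite set_nil setD0 => HO.
  have kR : 0 < k%:R :> R by rewrite ltr0n.
  have : f ([set:: A] :|: O) + f ([set:: B] :|: O)
        - 2 * (f [set:: A] + f [set:: B]) <= 2 * (f [set:: A] + f [set:: B]).
    rewrite -(ler_pM2l kR) (le_trans HO) // mulrCA mulrA ler_wpM2r ?addr_ge0 //.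
    by rewrite ler_wpM2l // ler_nat.
  have := submodular_lattice f_sub ([set:: A] :|: O) ([set:: B] :|: O).
  have -> : ([set:: A] :|: O) :&: ([set:: B] :|: O) = O.
    by rewrite -setUIl (disjoint_setI0 dAB) set0U.
  have := f_ge0 ([set:: A] :|: O :|: ([set:: B] :|: O)).
  have := growing_take gA; have := growing_take gB.
  by case: (lerP (f [set:: take k B]) (f [set:: take k A])); lra.
- move=> c; rewrite cardE; apply: reduces_trans (red _) _.
  by do 2!apply: reduces_query; apply: reduces_refl.
Qed.

End Twin.

(** * Local search by random swaps *)

Section Search.
Variables (R : realType) (T U : finType) (pr : {set U} -> {set T}).
Variables (m : nat) (e : 'I_m.+1 -> U) (tau : R).
Implicit Types (S X : {set U}) (u v x : U).

(** The answers [ys] follow the order of [enum S]; [u] is the witness that the arg max requires,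
    hence the condition [u \in S] in [scan_reduces]. *)
Definition best S u (ys : seq R) : U :=
  [arg max_(x > u | x \in S) nth 0 ys (index x (enum S))]%O.

Definition scan S u (c : U -> oalg R T) : oalg R T :=
  ask_all [seq pr (S :\ x) | x <- enum S] (fun ys => c (best S u ys)).

Definition move S v u (c : {set U} -> U -> oalg R T) : oalg R T :=
  if u \in S then c S v else
  Query (pr S) (fun a => Query (pr (S :\ v)) (fun b =>
  Query (pr (u |: S)) (fun d =>
    if tau < (d - a) - (a - b) then scan (u |: S :\ v) u (c (u |: S :\ v))
    else c S v))).

Fixpoint search (j : nat) S v : oalg R T :=
  if j is j'.+1 then Sample (fun i => move S v (e i) (search j'))
  else Ret R (pr S).

Variables (f : {set T} -> R) (F : {set U} -> R) (k : nat).
Hypothesis F_E : forall X, f (pr X) = F X.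
Hypothesis F_sub : submodular F.
Hypothesis tau_ge0 : 0 <= tau.

Definition state S v : Prop :=
  [/\ #|S| = k, v \in S & forall x, x \in S -> F (S :\ x) <= F (S :\ v)].

Lemma scan_reduces S u : #|S| = k -> u \in S ->
  exists v, state S v /\ forall c, reduces f k (scan S u c) (c v).
Proof.
move=> Sk uS; exists (best S u [seq F (S :\ x) | x <- enum S]); split.
  have val x : x \in S ->
      nth 0 [seq F (S :\ y) | y <- enum S] (index x (enum S)) = F (S :\ x).
    move=> xS; rewrite (nth_map x) ?nth_index ?index_mem ?mem_enum //.
  rewrite /best; case: arg_maxP => // v vS vmax; split=> // x xS.
  by rewrite -!val //; apply: vmax.
move=> c; have := ask_all_reduces f [seq pr (S :\ x) | x <- enum S]
  (fun ys => c (best S u ys)).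
by rewrite size_map -cardE Sk -map_comp (eq_map (fun x => F_E (S :\ x))).
Qed.

Definition gain S v u : R :=
  if u \in S then 0
  else Num.max 0 ((F (u |: S) - F S) - (F S - F (S :\ v)) - tau).

Lemma gain_ge0 S v u : 0 <= gain S v u.
Proof. by rewrite /gain; case: ifP => // _; rewrite le_max lexx. Qed.

Lemma move_reduces S v u : state S v -> exists S' v' q,
  [/\ state S' v', forall c, reduces f q (move S v u c) (c S' v'),
      F S + gain S v u <= F S'
    & (q <= 3)%N /\ F S' = F S \/ (q <= 3 + k)%N /\ F S + tau < F S'].
Proof.
move=> st; case: (st) => Sk vS vmax; have tau0 := tau_ge0.
rewrite /gain /move; case: (boolP (u \in S)) => uS.
  exists S, v, 0%N; split=> //; rewrite ?addr0 //; by left.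
set S1 := u |: S :\ v.
have S1k : #|S1| = k.
  by rewrite cardsU1 !inE (negbTE uS) andbF -Sk (cardsD1 v S) vS.
have [ltau|leta] := ltrP tau ((F (u |: S) - F S) - (F S - F (S :\ v))).
  have [v' [st' red']] := scan_reduces S1k (setU11 u _).
  (* The test uses the marginal of [u] over [S]; by submodularity the one over [S :\ v] is no
     smaller, so the swap gains at least the tested amount. *)
  have FS1 : (F (u |: S) - F S) - (F S - F (S :\ v)) <= F S1 - F S.
    by have := F_sub (subsetDl S [set v]) uS; rewrite -/S1; lra.
  exists S1, v', (3 + k)%N; split=> //.
  - by move=> c; do 3!apply: reduces_query; rewrite !F_E ltau; apply: red'.
  - by rewrite -lerBrDl ge_max; apply/andP; split; lra.
  - by right; split=> //; lra.
exists S, v, 3; split=> //; last by left.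
- move=> c; do 3!apply: reduces_query; rewrite !F_E (le_gtF leta).
  exact: reduces_refl.
- by rewrite -lerBrDl subrr ge_max lexx; lra.
Qed.

Lemma surely_search j S v (P : {set T} -> bool) : state S v -> (forall X, #|X| = k -> P (pr X)) ->
  surely (search j S v) f P.
Proof.
move=> st PX; elim: j S v st => [|j IH] S v st /=.
  by apply: PX; case: st.
apply/forallP => i; have [S' [v' [q [st' red _ _]]]] := move_reduces (e i) st.
by have [_ -> _] := red (search j); apply: IH.
Qed.

(** Here [p] is a budget of accepted swaps: each one uses up a unit, and at [p = 0] another would
    push [F] above [M]. *)
Lemma nqueries_search M j p S v :
  (forall X, #|X| = k -> F X <= M) -> state S v -> M <= F S + p%:R * tau ->
  (nqueries (search j S v) f <= (3 * j + p * k)%N)%N.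
Proof.
have tau0 := tau_ge0; move=> FM; elim: j p S v => [|j IH] p S v st Mp //=.
apply/bigmax_leqP => i _.
have [S' [v' [q [st' red _ alt]]]] := move_reduces (e i) st.
have [_ _ ->] := red (search j).
case: alt => [[q3 FS]|[q3 FS]].
  by have := IH p S' v' st'; rewrite FS => /(_ Mp); lia.
case: p Mp => [|p] Mp.
  by have := FM S'; case: st' => -> _ _ /(_ erefl); move: Mp; rewrite mul0r; lra.
have : M <= F S' + p%:R * tau by move: Mp; rewrite mulrS mulrDl mul1r; lra.
by move=> /(IH p S' v' st'); rewrite mulSn; lia.
Qed.

(** With [w] the least removal loss, each insertion from [X :\: S] gains at most [w + tau] plus its
    [gain], while each removal from [S :\: X] loses at least [w] in total account. Equal cardinals,
    ensured by padding, make the [w] terms cancel. *)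
Lemma local_opt S v lam X : state S v -> \sum_u gain S v u <= lam ->
  #|X| = k -> F (S :|: X) + F (S :&: X) <= 2 * F S + lam + k%:R * tau.
Proof.
move=> [Sk vS vmax] glam Xk; have tau0 := tau_ge0.
set w := F S - F (S :\ v).
have cD : #|S :\: X| = #|X :\: S|.
  by have := cardsID X S; have := cardsID S X; rewrite Sk Xk setIC; lia.
have lower : #|X :\: S|%:R * w <= F S - F (S :&: X).
  have -> : S :&: X = S :\: (S :\: X).
    by apply/setP=> x; rewrite !inE; case: (x \in S); rewrite ?andbF ?andbT ?negbK.
  apply: le_trans (submodular_setD_sum S (S :\: X) F_sub).
  rewrite -cD mulr_natl -sumr_const; apply: ler_sum => x.
  by rewrite inE => /andP[_ xS]; have := vmax x xS; rewrite /w; lra.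
have upper : F (S :|: X) - F S <= lam + #|X :\: S|%:R * (w + tau).
  have -> : S :|: X = S :|: X :\: S.
    by apply/setP=> x; rewrite !inE; case: (x \in S).
  apply: le_trans (submodular_setU_sum F_sub S (X :\: S)) _.
  apply: (@le_trans _ _ (\sum_(u in X :\: S) (gain S v u + (w + tau)))).
    apply: ler_sum => u; rewrite inE => /andP[uS _].
    by rewrite /gain (negbTE uS) -/w -lerBlDr le_max; apply/orP; right; lra.
  rewrite big_split sumr_const -[(w + tau) *+ _]mulr_natl lerD2r (le_trans _ glam) //.
  rewrite [leRHS](bigID (mem (X :\: S))) lerDl sumr_ge0 // => u _.
  exact: gain_ge0.
have : #|X :\: S|%:R * tau <= k%:R * tau.
  by rewrite ler_wpM2r // ler_nat -Xk subset_leq_card // subsetDl.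
lra.
Qed.

Hypothesis e_bij : bijective e.

(* Unless the current set is good, one step increases [F] by at least [lam / m.+1] in expectation. *)
Lemma prob_search M F0 lam (P : {set T} -> bool) I S v :
  (forall X, #|X| = k -> F X <= M) ->
  (forall X x, state X x -> F0 <= F X -> \sum_u gain X x u <= lam -> P (pr X)) ->
  0 <= lam -> state S v -> F0 <= F S ->
  lam * \sum_(j < I) (1 - prob (search j S v) f P) <= m.+1%:R * (M - F S).
Proof.
move=> FM goodP lam0; elim: I S v => [|I IH] S v st F0S.
  rewrite big_ord0 mulr0 mulr_ge0 // subr_ge0.
  by apply: FM; case: st.
have m0 : m.+1%:R != 0 :> R by rewrite pnatr_eq0.
rewrite big_ord_recl /=.
(* All terms but the first start with the same uniform move; averaging over it leaves the sum for
   [I] from the next state. *)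
have -> : \sum_(j < I) (1 - prob (search (bump 0 j) S v) f P)
    = (\sum_(i < m.+1) \sum_(j < I)
        (1 - prob (move S v (e i) (search j)) f P)) / m.+1%:R.
  rewrite exchange_big mulr_suml; apply: eq_bigr => j _ /=.
  by rewrite sumrB sumr_const card_ord mulrBl divff.
have sum_gain : \sum_u gain S v u = \sum_i gain S v (e i).
  by rewrite (reindex e) //; apply: onW_bij.
have steps : lam * \sum_(i < m.+1) \sum_(j < I)
      (1 - prob (move S v (e i) (search j)) f P)
    <= m.+1%:R * (m.+1%:R * (M - F S) - \sum_u gain S v u).
  rewrite sum_gain.
  have -> : m.+1%:R * (m.+1%:R * (M - F S) - \sum_i gain S v (e i))
     = \sum_(i < m.+1) (m.+1%:R * (M - F S - gain S v (e i))).
    by rewrite -mulr_sumr sumrB sumr_const card_ord -[(M - F S) *+ _]mulr_natl.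
  rewrite mulr_sumr; apply: ler_sum => i _.
  have [S' [v' [q [st' red FS' _]]]] := move_reduces (e i) st.
  have g0 := gain_ge0 S v (e i).
  rewrite (eq_bigr (fun j : 'I_I => 1 - prob (search j S' v') f P)); last first.
    by move=> j _; have [-> _ _] := red (search j).
  apply: le_trans (IH S' v' st' _) _; first by lra.
  by rewrite ler_wpM2l //; lra.
(* The term for stopping at once is zero on a good set; otherwise the total gain exceeds [lam]. *)
have first : lam * (1 - (if P (pr S) then 1 else 0)) <= \sum_u gain S v u.
  case: ifP => [_|nP]; first by rewrite subrr mulr0 sumr_ge0 // => u _; exact: gain_ge0.
  rewrite subr0 mulr1 leNgt; apply/negP => /ltW /(goodP _ _ st F0S).
  by rewrite nP.
rewrite mulrDr mulrA.
apply: le_trans (lerD first (_ : _ <= m.+1%:R * (M - F S) - \sum_u gain S v u)) _.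
  by rewrite ler_pdivrMr ?ltr0n // [leRHS]mulrC.
lra.
Qed.

End Search.

(** * Dummy elements *)

Section Dummies.
Variables (T : finType) (k : nat).
Implicit Types (S : {set T}) (X : {set T + 'I_k}).

Definition undummy X : {set T} := inl @^-1: X.

Definition pad S : {set T + 'I_k} :=
  inl @: S :|: inr @: [set:: take (k - #|S|) (enum 'I_k)].

Lemma undummyU X Y : undummy (X :|: Y) = undummy X :|: undummy Y.
Proof. exact: preimsetU. Qed.

Lemma undummyI X Y : undummy (X :&: Y) = undummy X :&: undummy Y.
Proof. exact: preimsetI. Qed.

Lemma card_undummy X : (#|undummy X| <= #|X|)%N.
Proof.
rewrite -(card_imset (mem (undummy X)) (@inl_inj T 'I_k)) subset_leq_card //.
by rewrite sub_imset_pre.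
Qed.

Lemma padK S : undummy (pad S) = S.
Proof.
apply/setP=> x; rewrite !inE mem_imset; last exact: inl_inj.
by case: imsetP => [[i _]|]; rewrite ?orbF.
Qed.

Lemma card_pad S : (#|S| <= k)%N -> #|pad S| = k.
Proof.
move=> Sk; rewrite cardsU (_ : _ :&: _ = set0); last first.
  apply/setP=> x; rewrite !inE; apply/negbTE/negP => /andP[].
  by case/imsetP=> y _ ->; case/imsetP.
rewrite cards0 subn0 !card_imset; [|exact: inr_inj|exact: inl_inj].
rewrite cardsE (card_uniqP _) ?take_uniq ?enum_uniq //.
by rewrite size_takel ?subnKC // size_enum_ord leq_subr.
Qed.

Lemma submodular_undummy (R : realType) (f : {set T} -> R) :
  submodular f -> submodular (fun X => f (undummy X)).
Proof.
move=> f_sub A B [t|i] sAB sB; rewrite !undummyU.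
  have -> : undummy [set inl t] = [set t] by apply/setP=> x; rewrite !inE.
  by apply: f_sub; [exact: preimsetS|rewrite inE].
have -> : undummy [set inr i] = set0 by apply/setP=> x; rewrite !inE.
by rewrite !set0U !subrr.
Qed.

End Dummies.

(** * The complete algorithm and its guarantees *)

Section Algorithm.
Variables (R : realType) (T : finType) (k N m : nat) (eps : R).
Hypothesis k_gt0 : (0 < k)%N.
Variable e : 'I_m.+1 -> T + 'I_k.

(** Any element of [X] will do, as it only seeds the first [scan]; the default dummy is never
    reached when [#|X| = k]. *)
Definition pivot (X : {set T + 'I_k}) : T + 'I_k :=
  odflt (inr (Ordinal k_gt0)) [pick x in X].

Lemma pivotP (X : {set T + 'I_k}) : #|X| = k -> pivot X \in X.
Proof.
rewrite /pivot; case: pickP => //= X0 Xk.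
by have := k_gt0; rewrite -[X in (0 < X)%N]Xk (eq_card0 X0).
Qed.

(** The stopping time is drawn before the search; [.-1.+1] gives [N * m.+1] the successor shape that
    [Sample] demands. *)
Definition local_search : oalg R T :=
  start k (fun S0 => Query S0 (fun a => let X0 := pad k S0 in
    scan (@undummy T k) X0 (pivot X0) (fun v0 =>
      Sample (fun j : 'I_((N * m.+1).-1.+1) =>
        search (@undummy T k) e (eps * a / (2 * k%:R)) j X0 v0)))).

Variable f : {set T} -> R.
Hypothesis f_ge0 : nonneg f.
Hypothesis f_sub : submodular f.

Let F (X : {set T + 'I_k}) : R := f (undummy X).
Let F_E X : f (undummy X) = F X. Proof. by []. Qed.

Lemma local_search_reduces : exists (S0 : {set T}) (v0 : T + 'I_k),
  [/\ (#|S0| <= k)%N, forall O : {set T}, (#|O| <= k)%N -> f O <= 16 * f S0,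
      state F k (pad k S0) v0
    & reduces f (4 * #|T| + 3 + k) local_search
        (Sample (fun j : 'I_((N * m.+1).-1.+1) =>
          search (@undummy T k) e (eps * f S0 / (2 * k%:R)) j (pad k S0) v0))].
Proof.
have [S0 [S0k S0max red]] := start_reduces k_gt0 f_sub f_ge0.
have Xk := card_pad S0k.
have [v0 [st red']] := scan_reduces F_E Xk (pivotP Xk).
exists S0, v0; split=> //.
rewrite (_ : (4 * #|T| + 3 + k = 4 * #|T| + 2 + k.+1)%N); last by lia.
apply: reduces_trans (red _) _; apply: reduces_query; exact: red'.
Qed.

Lemma local_opt_good (tau lam : R) X v (O : {set T}) : 0 < eps -> 0 <= tau ->
  lam + k%:R * tau <= eps * F X -> state F k X v ->
  \sum_u gain tau F X v u <= lam -> (#|O| <= k)%N ->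
  good f k eps O (undummy X).
Proof.
move=> eps0 tau0 err st glam Ok.
have F_sub : submodular F := submodular_undummy f_sub.
have opt (P : {set T}) : (#|P| <= k)%N ->
    f (undummy X :|: P) + f (undummy X :&: P) <= (2 + eps) * f (undummy X).
  move=> Pk; have := local_opt F_sub tau0 st glam (card_pad Pk).
  rewrite /F undummyU undummyI padK; move: err; rewrite /F; lra.
have Xk : (#|undummy X| <= k)%N by case: st => /eq_leq + _ _; apply: leq_trans (card_undummy X).
apply/and3P; split=> //.
  rewrite ler_pdivrMr; last by lra.
  by rewrite addrC mulrC; apply: opt.
rewrite ler_pdivrMr; last by lra.
(* The union with this set is [undummy X] itself, so one copy of its value cancels and [2 + eps]
   becomes [1 + eps]. *)
have := opt (undummy X :&: O).
rewrite setIA setIid (setUidPl (subsetIl _ _)).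
move=> /(_ (leq_trans (subset_leq_card (subsetIl _ _)) Xk)); lra.
Qed.

Lemma surely_local_search (P : {set T} -> bool) :
  0 < eps -> (forall S : {set T}, (#|S| <= k)%N -> P S) ->
  surely local_search f P.
Proof.
move=> eps0 PS; have [S0 [v0 [_ _ st [_ -> _]]]] := local_search_reduces.
apply/forallP => j /=; apply: (surely_search e F_E) st _.
- exact: submodular_undummy.
- by rewrite divr_ge0 ?mulr_ge0 // ltW.
- by move=> X Xk; rewrite PS // (leq_trans (card_undummy X)) ?Xk.
Qed.

Lemma nqueries_local_search : 0 < eps -> 32 <= N%:R * eps ->
  (nqueries local_search f
     <= 4 * #|T| + 3 + k + (3 * (N * m.+1) + N * k * k))%N.
Proof.
move=> eps0 Neps; have [S0 [v0 [S0k S0max st [_ _ ->]]]] := local_search_reduces.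
rewrite leq_add2l; apply/bigmax_leqP => j _.
have k0 : k%:R != 0 :> R by rewrite pnatr_eq0 -lt0n.
apply: leq_trans (_ : _ <= 3 * j + N * k * k)%N _; last first.
  by have := ltn_ord j; have : (0 < N * m.+1)%N; [case: N Neps => //; rewrite mul0r; lra|lia].
have tau0 : 0 <= eps * f S0 / (2 * k%:R) by rewrite divr_ge0 ?mulr_ge0 // ltW.
have FM (X : {set T + 'I_k}) : #|X| = k -> F X <= 16 * f S0.
  by move=> Xk; apply: S0max; rewrite (leq_trans (card_undummy X)) ?Xk.
(* The swap budget is [N * k], since [N * k * tau] equals [N * eps / 2 * f S0], which is at least
   [16 * f S0]. *)
apply: (nqueries_search e F_E (submodular_undummy f_sub) tau0 _ FM st).
rewrite /F padK natrM.
have -> : N%:R * k%:R * (eps * f S0 / (2 * k%:R)) = N%:R * eps / 2 * f S0.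
  by field.
have : 16 * f S0 <= N%:R * eps / 2 * f S0.
  by rewrite ler_wpM2r //; lra.
have := f_ge0 S0; lra.
Qed.

Hypothesis e_bij : bijective e.

Lemma prob_local_search (O : {set T}) : 0 < eps -> 32 <= N%:R * eps ^+ 2 ->
  (#|O| <= k)%N -> 1 - eps <= prob local_search f (good f k eps O).
Proof.
move=> eps0 Neps Ok.
have [S0 [v0 [S0k S0max st [pE _ _]]]] := local_search_reduces.
(* If [f S0 = 0], then [f] vanishes on all sets of size at most [k] and every output is good;
   otherwise [f S0] can be cancelled below. *)
have [f0|f0] := ltrP 0 (f S0); last first.
  rewrite surely_prob; first by lra.
  apply: surely_local_search => // S Sk.
  have f_le0 (P : {set T}) : (#|P| <= k)%N -> f P = 0.
    by move=> /S0max fP; apply: le_anti; rewrite f_ge0 andbT; lra.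
  have := submodular_lattice f_sub S O.
  have SO0 : f (S :&: O) = 0.
    by apply: f_le0; apply: leq_trans Sk; rewrite subset_leq_card ?subsetIl.
  rewrite /good Sk SO0 mul0r f_ge0 (f_le0 S Sk) (f_le0 O Ok) !(add0r, addr0) /=.
  by move=> SO; rewrite ler_pdivrMr ?mul0r //; lra.
rewrite pE /=; set L := (N * m.+1).-1.+1.
have LE : L = (N * m.+1)%N.
  by rewrite /L prednK // muln_gt0 andbT; case: N Neps => //; rewrite mul0r; lra.
set tau := eps * f S0 / (2 * k%:R).
have k0 : k%:R != 0 :> R by rewrite pnatr_eq0 -lt0n.
(* The allowed error [eps * f S0] is split evenly between [k%:R * tau] and [lam]. *)
have ktau : k%:R * tau = eps * f S0 / 2 by rewrite /tau; field.
have tau0 : 0 <= tau by rewrite divr_ge0 ?mulr_ge0 // ltW.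
have FS0 : F (pad k S0) = f S0 by rewrite /F padK.
have lam0 : 0 <= eps * f S0 / 2 by rewrite divr_ge0 // mulr_ge0 // ltW.
have FM (X : {set T + 'I_k}) : #|X| = k -> F X <= 16 * f S0.
  by move=> Xk; apply: S0max; rewrite (leq_trans (card_undummy X)) ?Xk.
have goodX (X : {set T + 'I_k}) x : state F k X x -> f S0 <= F X ->
    \sum_u gain tau F X x u <= eps * f S0 / 2 -> good f k eps O (undummy X).
  move=> stX FX gX; apply: local_opt_good gX Ok => //; rewrite ktau.
  have : eps * f S0 <= eps * F X by rewrite ler_pM2l.
  lra.
have := prob_search F_E (submodular_undummy f_sub) tau0 e_bij L FM goodX lam0 st.
rewrite FS0 lexx => /(_ isT).
rewrite sumrB sumr_const card_ord.
set p := \sum_(j < L) _ => H.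
rewrite ler_pdivlMr ?ltr0n //.
(* After cancelling [f S0], the sum [L - p] of failure probabilities is at most [32 * m.+1 / eps],
   hence at most [eps * L] by the choice of [N]. *)
have {}H : f S0 * (eps / 2 * (L%:R - p)) <= f S0 * (16 * m.+1%:R).
  apply: le_trans (_ : m.+1%:R * (16 * f S0 - f S0) <= _); first by lra.
  have : 0 <= m.+1%:R * f S0 by rewrite mulr_ge0 // ltW.
  lra.
move: H; rewrite ler_pM2l // => H.
have : 32 * m.+1%:R <= eps * (eps * L%:R).
  by rewrite LE natrM !mulrA -expr2 [_ * N%:R]mulrC ler_wpM2r.
move=> HL; rewrite -(ler_pM2l eps0); lra.
Qed.

End Algorithm.

Theorem mainTheorem2 (R : realType) (eps : R) (Heps : 0 < eps < 1) :
  exists C : nat,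
  forall (T : finType) (k : nat), (0 < k)%N ->
  exists A : oalg R T,
    forall f : {set T} -> R,
      nonneg f -> submodular f ->
         (nqueries A f <= C * (#|T| + k ^ 2))%N /\
         surely A f (fun S => (#|S| <= k)%N) /\
         forall O : {set T}, is_opt f k O ->
           1 - eps <= prob A f (good f k eps O).
Proof.
have /andP[eps0 eps1] := Heps.
pose N := Num.Def.archi_bound (32 / eps ^+ 2).
have N2 : 32 <= N%:R * eps ^+ 2.
  rewrite -ler_pdivrMr ?exprn_gt0 // ltW // archi_boundP //.
  by rewrite divr_ge0 // exprn_ge0 // ltW.
have N1 : 32 <= N%:R * eps.
  apply: le_trans N2 _; rewrite expr2 ler_wpM2l // -[leRHS]mul1r ler_wpM2r ?ltW //.
(* As [1 <= k <= k ^ 2], both [3 + k <= 4 * k ^ 2] and [3 * N * k + N * k ^ 2 <= 4 * N * k ^ 2]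
   hold. *)
exists (4 + 4 * N)%N => T k k_gt0.
have cardU : #|{: T + 'I_k}| = (#|T| + k).-1.+1.
  by rewrite card_sum card_ord prednK // addn_gt0 k_gt0 orbT.
pose e i := enum_val (cast_ord (esym cardU) i).
have e_bij : bijective e.
  apply: bij_comp; first exact: enum_val_bij.
  by exists (cast_ord cardU) => i; apply/val_inj.
exists (local_search N eps k_gt0 e) => f f_ge0 f_sub; split; [|split].
- apply: leq_trans (nqueries_local_search k_gt0 e f_ge0 f_sub eps0 N1) _.
  rewrite prednK ?addn_gt0 ?k_gt0 ?orbT // expnS expn1.
  have : (k <= k * k)%N by rewrite leq_pmulr.
  nia.
- exact: surely_local_search.
- by move=> O [Ok _]; apply: prob_local_search.
Qed.
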